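(* Consider chip configurations $z=(z_0,\dots,z_4)\in\mathbb Z[i]^5$ on the nodes $0,\dots,4$ of a pentagon, modulo firing equivalence $z\sim z'\iff z-z'\in\overline{\mathcal K}\,\mathbb Z[i]^5$, where \[\overline{\mathcal K}=\begin{bmatrix} 1 + i & -i & 0 & 0 & -i \\ -i & 1 + i & -i & 0 & 0 \\ 0 & -i & 1 + i & -i & 0 \\ 0 & 0 & -i & 1 + i & -i \\ -i & 0 & 0 & -i & 1 + i \end{bmatrix}.\] Fix one node $d$ (the distinguished node). Then the $162$ configurations $z\in\mathbb Z^5$ (no imaginary chips) with $z_d\in\{0,3\}$ and $z_k\in\{0,1,2\}$ for every $k\neq d$ form a complete set of representatives of the firing equivalence classes: every configuration is firing equivalent to exactly one of them.
   Context: For a configuration $z$, node $k$ carries $\operatorname{Re}z_k$ real chips and $\operatorname{Im}z_k$ imaginary chips. The group of firing equivalence classes $\mathbb Z[i]^5/\overline{\mathcal K}\,\mathbb Z[i]^5$ is isomorphic to the sandpile group $S(R_{10})$ of the regular matroid $R_{10}$ (represented over $\mathbb R$ by $\begin{bmatrix}I_5&\mathcal D\end{bmatrix}$ where $\overline{\mathcal K}=I_5+i\mathcal D$), a group of order $162$. *)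

(* Defs.v *)
From HB Require Import structures.
From mathcomp Require Import all_boot all_order all_algebra.
From mathcomp Require Import complex.

Set Implicit Arguments.
Unset Strict Implicit.
Unset Printing Implicit Defensive.

Import GRing.Theory.
Local Open Scope ring_scope.

(* real_closed equips R[i] with a ring structure only when R is a field; here
   its multiplication [ComplexField.mulc] is turned into the ring structure of
   the Gaussian integers Z[i], on an alias of int[i]. *)
Definition gaussInt : Type := complex int.

HB.instance Definition _ := GRing.Zmodule.copy gaussInt (complex int).

Definition gauss_one : gaussInt := Complex 1 0.
Definition gauss_mul : gaussInt -> gaussInt -> gaussInt :=
  @ComplexField.mulc int.

Fact gauss_mulA : associative gauss_mul.
Proof. exact: ComplexField.mulcA. Qed.

Fact gauss_mulC : commutative gauss_mul.
Proof. exact: ComplexField.mulcC. Qed.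

Fact gauss_mul1 : left_id gauss_one gauss_mul.
Proof. by case=> a b; rewrite /gauss_mul /= !mul1r !mul0r subr0 addr0. Qed.

Fact gauss_mulDl : left_distributive gauss_mul +%R.
Proof.
case=> a b [c d] [e f]; rewrite /gauss_mul /= !mulrDl opprD.
by congr Complex; rewrite addrACA.
Qed.

Fact gauss_one_neq0 : gauss_one != 0.
Proof. by []. Qed.

HB.instance Definition _ := GRing.Zmodule_isComNzRing.Build gaussInt
  gauss_mulA gauss_mulC gauss_mul1 gauss_mulDl gauss_one_neq0.

Definition gauss_i : gaussInt := Complex 0 1.

Definition config := 'cV[gaussInt]_5.

Definition Kbar : 'M[gaussInt]_5 :=
  let i := gauss_i in
  \matrix_(r < 5, c < 5) nth 0 (nth [::]
   [:: [:: 1 + i;   - i;     0;     0;   - i];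
       [::   - i; 1 + i;   - i;     0;     0];
       [::     0;   - i; 1 + i;   - i;     0];
       [::     0;     0;   - i; 1 + i;   - i];
       [::   - i;     0;     0;   - i; 1 + i]] r) c.

Definition firing_equiv (z z' : config) : Prop :=
  exists w : config, z - z' = Kbar *m w.

Definition representative (d : 'I_5) (z : config) : Prop :=
  [/\ forall k : 'I_5, Im (z k 0) = 0,
      Re (z d 0) \in [:: 0; 3]
    & forall k : 'I_5, k != d -> Re (z k 0) \in [:: 0; 1; 2]].

(* Main.v *)
(* Write Kbar = 1 + iD with D real.  In the quotient by Kbar the scalar i acts
   as D, so z = x + iy has the same class as the real configuration x + Dy, and
   the quotient is Z^5 / (1 + D^2).  On the pentagon 1 + D^2 = 3D + J, where J
   is the all-ones matrix, and D is unimodular; hence v lies in the image of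
   1 + D^2 iff its entries are congruent modulo 3 and their sum is even. *)
Require Import Defs.
From mathcomp Require Import all_boot all_order all_algebra.
From mathcomp Require Import complex zify.

Set Implicit Arguments.
Unset Strict Implicit.
Unset Printing Implicit Defensive.

Import GRing.Theory.
Local Open Scope ring_scope.

(** * Real and imaginary parts of Gaussian matrices *)

(* Typed copies of the projections, so that they unify with [map_mx] over
   [gaussInt] rather than [complex int]. *)
Definition reP (z : gaussInt) : int := Re z.
Definition imP (z : gaussInt) : int := Im z.

Lemma rePD (x y : gaussInt) : reP (x + y) = reP x + reP y.
Proof. by case: x; case: y. Qed.

Lemma imPD (x y : gaussInt) : imP (x + y) = imP x + imP y.
Proof. by case: x; case: y. Qed.

Lemma rePB (x y : gaussInt) : reP (x - y) = reP x - reP y.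
Proof. by case: x; case: y. Qed.

Lemma imPB (x y : gaussInt) : imP (x - y) = imP x - imP y.
Proof. by case: x; case: y. Qed.

Lemma rePM (x y : gaussInt) : reP (x * y) = reP x * reP y - imP x * imP y.
Proof. by case: x; case: y. Qed.

Lemma imPM (x y : gaussInt) : imP (x * y) = reP x * imP y + imP x * reP y.
Proof. by case: x => a b; case: y => c e /=; rewrite [b * c]mulrC. Qed.

Section GaussMatrix.
Variables m n p : nat.
Implicit Types (A : 'M[gaussInt]_(m, n)) (B : 'M[gaussInt]_(n, p)).

Lemma map_reP_mul A B : map_mx reP (A *m B)
  = map_mx reP A *m map_mx reP B - map_mx imP A *m map_mx imP B.
Proof.
apply/matrixP=> i j; rewrite !mxE (big_morph reP rePD (erefl _ : reP 0 = 0)).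
by rewrite -sumrB; apply: eq_bigr => k _; rewrite rePM !mxE.
Qed.

Lemma map_imP_mul A B : map_mx imP (A *m B)
  = map_mx reP A *m map_mx imP B + map_mx imP A *m map_mx reP B.
Proof.
apply/matrixP=> i j; rewrite !mxE (big_morph imP imPD (erefl _ : imP 0 = 0)).
by rewrite -big_split; apply: eq_bigr => k _; rewrite imPM !mxE.
Qed.

Lemma gauss_matrixP A A' :
  map_mx reP A = map_mx reP A' -> map_mx imP A = map_mx imP A' -> A = A'.
Proof.
move=> /matrixP eR /matrixP eI; apply/matrixP=> i j.
move: (eR i j) (eI i j); rewrite !mxE.
by case: (A i j) (A' i j) => ? ? [? ?] /= -> ->.
Qed.

Lemma map_rePB A A' : map_mx reP (A - A') = map_mx reP A - map_mx reP A'.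
Proof. by apply/matrixP=> i j; rewrite !mxE rePB. Qed.

Lemma map_imPB A A' : map_mx imP (A - A') = map_mx imP A - map_mx imP A'.
Proof. by apply/matrixP=> i j; rewrite !mxE imPB. Qed.

End GaussMatrix.

(** * The pentagon matrix D and the image of 1 + D^2 *)

Definition Dmx : 'M[int]_5 := map_mx imP Kbar.

(** Since DJ = -J, the identity 1 + D^2 = 3D + J rearranges to D(3 - D - J) = 1. *)
Definition Dinv : 'M[int]_5 := 3%:M - Dmx - const_mx 1.

Ltac case_ord5 :=
  case=> [] [|[|[|[|[|?]]]]] // ?.

Lemma reP_Kbar : map_mx reP Kbar = 1%:M.
Proof. by apply/matrixP; case_ord5; case_ord5; rewrite !mxE. Qed.

Lemma Dmx_sqr : 1%:M + Dmx *m Dmx = 3 *: Dmx + const_mx 1.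
Proof.
by apply/matrixP; case_ord5; case_ord5; rewrite !mxE !big_ord_recl big_ord0 !mxE.
Qed.

Lemma Dmx_ones n : Dmx *m const_mx 1 = - const_mx 1 :> 'M_(5, n).
Proof.
by apply/matrixP; case_ord5 => j; rewrite !mxE !big_ord_recl big_ord0 !mxE.
Qed.

Lemma Dmx_inv : Dmx *m Dinv = 1%:M.
Proof.
rewrite !mulmxBr Dmx_ones opprK mul_mx_scalar addrAC -Dmx_sqr.
exact: addrK.
Qed.

Lemma ones_Dmx : const_mx 1 *m Dmx = - const_mx 1 :> 'M_5.
Proof.
by apply/matrixP; case_ord5; case_ord5; rewrite !mxE !big_ord_recl big_ord0 !mxE.
Qed.

Lemma ones_Dinv : const_mx 1 *m Dinv = - const_mx 1 :> 'M_5.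
Proof. by rewrite -[RHS]mulmx1 -Dmx_inv mulmxA mulNmx ones_Dmx opprK. Qed.

Lemma ones_mul (v : 'cV[int]_5) :
  const_mx 1 *m v = const_mx (\sum_k v k 0) :> 'cV_5.
Proof.
apply/matrixP=> i j; rewrite !mxE ord1.
by apply: eq_bigr => k _; rewrite mxE mul1r.
Qed.

Lemma image_1DD (v : 'cV[int]_5) :
  (exists a, v = (1%:M + Dmx *m Dmx) *m a) <->
  (exists c : int, forall k, (3 %| (v k 0 - c)%R)%Z) /\ (2 %| (\sum_k v k 0)%R)%Z.
Proof.
rewrite Dmx_sqr; split=> [[a ->]|[[c vc] v2]].
  have E k : ((3 *: Dmx + const_mx 1) *m a) k 0
             = 3 * (Dmx *m a) k 0 + \sum_l a l 0.
    by rewrite mulmxDl -scalemxAl ones_mul !mxE.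
  split; first by exists (\sum_l a l 0) => k; rewrite E addrK dvdz_mulr.
  rewrite (eq_bigr _ (fun k _ => E k)) big_split -mulr_sumr /=.
  (* Each column of D sums to -1. With S the sum of [a], the entries of [v] then add up to -3S + 5S
     = 2S. *)
  have -> : \sum_k (Dmx *m a) k 0 = - \sum_k a k 0.
    have := congr1 (fun w : 'cV[int]_5 => w 0 0) (ones_mul (Dmx *m a)).
    by rewrite mulmxA ones_Dmx mulNmx ones_mul !mxE => <-.
  by rewrite sumr_const card_ord; move: (\sum_k a k 0) => S; lia.
pose u : 'cV[int]_5 := \col_k ((v k 0 - c)%R %/ 3)%Z.
have vE k : v k 0 = 3 * u k 0 + c.
  by rewrite mxE mulrC divzK // subrK.
(* The entries of [v] add up to 3U + 5c, with U the sum of [u], so evenness passes to c + U. *)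
have [t tE] : exists t : int, 2 * t = c + \sum_k u k 0.
  exists ((c + \sum_k u k 0)%R %/ 2)%Z; rewrite mulrC divzK //.
  move: v2; rewrite (eq_bigr _ (fun k _ => vE k)) big_split -mulr_sumr /=.
  by rewrite sumr_const card_ord; move: (\sum_k u k 0) => S; lia.
(* 3D + J sends [Dinv *m u] to 3u minus the constant vector U, and the all-ones vector to twice
   itself; reaching 3u + c thus requires 2t = c + U. *)
exists (Dinv *m u + t *: const_mx 1).
apply/matrixP=> k j; rewrite ord1 vE mulmxDl !mulmxDr -!scalemxAl -!scalemxAr.
rewrite !mulmxA Dmx_inv ones_Dinv mul1mx Dmx_ones mulNmx !ones_mul !mxE.
under [X in _ = _ + (_ + t * X)]eq_bigr do rewrite mxE.
by rewrite sumr_const card_ord; move: (\sum_k u k 0) tE => S; lia.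
Qed.

(** * Reduction of firing equivalence to real configurations *)

Definition realize (z : config) : 'cV[int]_5 :=
  map_mx reP z + Dmx *m map_mx imP z.

Lemma realizeB (z z' : config) : realize (z - z') = realize z - realize z'.
Proof. by rewrite /realize map_rePB map_imPB mulmxBr opprD addrACA. Qed.

Lemma image_Kbar (z : config) :
  (exists w, z = Kbar *m w) <->
  (exists a, realize z = (1%:M + Dmx *m Dmx) *m a).
Proof.
split=> [[w ->]|[a]].
  (* For w = p + iq the product is (p - Dq) + i(q + Dp); realizing it cancels q and leaves (1 +
     D^2)p. *)
  exists (map_mx reP w); rewrite /realize map_reP_mul map_imP_mul reP_Kbar.
  by rewrite !mul1mx mulmxDr mulmxDl mul1mx addrA subrK mulmxA.
(* With [a] as real part of the preimage, matching imaginary parts forces [b]; the real parts then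
   agree by [za]. *)
rewrite mulmxDl mul1mx => za; pose b := map_mx imP z - Dmx *m a.
pose w : config := \col_k Complex (a k 0) (b k 0).
have wa : map_mx reP w = a by apply/matrixP=> k j; rewrite !mxE ord1.
have wb : map_mx imP w = b by apply/matrixP=> k j; rewrite !mxE ord1.
exists w; apply: gauss_matrixP.
  rewrite map_reP_mul reP_Kbar mul1mx wa wb mulmxBr mulmxA opprB addrA.
  by rewrite -[a + _]za addrK.
by rewrite map_imP_mul reP_Kbar mul1mx wa wb subrK.
Qed.

Lemma firing_equivP (z z' : config) :
  firing_equiv z z' <->
  (exists c : int, forall k, (3 %| (realize z k 0 - realize z' k 0 - c)%R)%Z)
  /\ (2 %| (\sum_k (realize z k 0 - realize z' k 0))%R)%Z.
Proof.
have E k : realize (z - z') k 0 = realize z k 0 - realize z' k 0.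
  by rewrite realizeB [LHS]mxE [X in _ + X]mxE.
rewrite /firing_equiv image_Kbar image_1DD; under eq_bigr do rewrite E.
by split=> -[[c zc] ?]; split=> //; exists c => k; move: (zc k); rewrite E.
Qed.

(** * Enumeration of the representatives *)

Definition real_config (f : 'I_5 -> int) : config := \col_k Complex (f k) 0.

Lemma realize_real f k : realize (real_config f) k 0 = f k.
Proof.
rewrite /realize (_ : map_mx imP _ = 0) ?mulmx0 ?addr0 ?mxE //.
by apply/matrixP=> i j; rewrite !mxE.
Qed.

Lemma representativeP d z :
  representative d z <->
  exists f, [/\ z = real_config f, f d \in [:: 0; 3]
              & forall k, k != d -> f k \in [:: 0; 1; 2]].
Proof.
split=> [[z0 zd zk]|[f [-> fd fk]]]; last first.
  by split=> [k||k kd]; rewrite mxE //; apply: fk.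
exists (fun k => Re (z k 0)); split=> //; apply/matrixP=> k j.
by rewrite mxE ord1; move: (z0 k); case: (z k 0) => a b /= ->.
Qed.

Lemma real_config_inj f g : real_config f = real_config g -> f =1 g.
Proof.
by move=> fg k; have := congr1 (fun z => realize z k 0) fg; rewrite !realize_real.
Qed.

(** Indexing by a finite type with 2 * 3^4 = 162 elements makes the count immediate; [unlift d]
    separates [d] from the other four nodes. *)
Definition rep_config (d : 'I_5) (p : bool * {ffun 'I_4 -> 'I_3}) : config :=
  real_config (fun k => if unlift d k is Some j then Posz (p.2 j)
                        else if p.1 then 3 else 0).

Lemma rep_config_inj d : injective (rep_config d).
Proof.
move=> [b f] [b' f'] /real_config_inj E; congr pair.
  by move: (E d); rewrite unlift_none /=; case: b {E}; case: b'.
by apply/ffunP=> j; apply/val_inj; move: (E (lift d j)); rewrite liftK /= => -[].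
Qed.

Lemma rep_configP d z : representative d z <-> exists p, z = rep_config d p.
Proof.
rewrite representativeP; split=> [[f [-> fd fk]]|[p ->]].
  exists (f d == 3, [ffun j => inord `|f (lift d j)|%N]).
  apply/matrixP=> k j; rewrite !mxE; congr Complex.
  case: unliftP => [l|] -> /=; last by move: fd; rewrite !inE => /orP[] /eqP->.
  have /fk : lift d l != d by rewrite eq_sym neq_lift.
  by rewrite ffunE !inE => /or3P[] /eqP->; rewrite inordK.
eexists; split; first by [].
  by rewrite /= unlift_none; case: p.1.
move=> k; rewrite eq_sym => /unlift_some[j _ ->].
by case: (p.2 j) => [] [|[|[|]]].
Qed.

(** * Existence and uniqueness of the representative *)

Lemma firing_equiv_rep d z :
  exists r, representative d r /\ firing_equiv z r.
Proof.
pose v k := realize z k 0.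
(* Residues matter only up to a common shift; this one makes [g d] zero. *)
pose g k := ((v k - v d)%R %% 3)%Z.
(* Adding 3 at [d] keeps all residues modulo 3 and flips the parity of the sum. *)
pose b : int := if (2 %| (\sum_k (v k - g k))%R)%Z then 0 else 3.
pose f k := g k + (if k == d then b else 0).
exists (real_config f); split.
  apply/representativeP; exists f; split=> // [|k /negbTE kd].
    by rewrite /f /g eqxx subrr mod0z add0r /b; case: ifP.
  by rewrite /f kd addr0 !inE /g; lia.
apply/firing_equivP; split.
  exists (v d) => k; rewrite realize_real -/(v k) /f /g /b.
  by case: (k == d); [case: ifP => _|]; lia.
under eq_bigr => k _ do rewrite realize_real -/(v k) /f opprD addrA.
rewrite sumrB -big_mkcond big_pred1_eq /b.
by case: ifP; move: (\sum_k (v k - g k)) => S; lia.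
Qed.

Lemma firing_equiv_rep_uniq d r r' :
  representative d r -> representative d r' -> firing_equiv r r' -> r = r'.
Proof.
move=> /representativeP[f [-> fd fk]] /representativeP[f' [-> fd' fk']].
move=> /firing_equivP[[c H3] H2].
have E3 k : (3 %| (f k - f' k - c)%R)%Z by have := H3 k; rewrite !realize_real.
(* Both values at [d] are multiples of 3, hence so is [c]; elsewhere, congruent values in {0, 1, 2}
   coincide. *)
have Ek k : k != d -> f k = f' k.
  move=> kd; have := E3 k; have := E3 d.
  move: fd fd' (fk k kd) (fk' k kd); rewrite !inE; lia.
(* Only the term at [d] survives in the sum, and its evenness rules out a difference of 3. *)
have Ed : f d = f' d.
  move: H2; under eq_bigr do rewrite !realize_real.
  rewrite (bigD1 d) //= big1 => [|k /Ek->]; last by rewrite subrr.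
  by move: fd fd'; rewrite !inE; lia.
apply/matrixP=> k j; rewrite !mxE; congr Complex.
by case: (eqVneq k d) => [->|/Ek].
Qed.

Theorem theorem3p7 (d : 'I_5) :
  (exists s : seq config,
      [/\ uniq s, size s = 162
        & forall z : config, z \in s <-> representative d z])
  /\ (forall z : config,
        exists! r : config, representative d r /\ firing_equiv z r).
Proof.
split.
  exists (codom (rep_config d)); split=> [||z].
  - by rewrite map_inj_uniq ?enum_uniq //; apply: rep_config_inj.
  - by rewrite size_codom card_prod card_bool card_ffun !card_ord.
  - rewrite rep_configP; split=> [/codomP//|[p ->]]; exact: codom_f.
move=> z; have [r [rd zr]] := firing_equiv_rep d z.
exists r; split=> // r' [rd' zr'].
apply: (firing_equiv_rep_uniq rd rd').
(* The witness comes from r - r' = (z - r') - (z - r). *)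
case: zr zr' => w zw [w' zw']; exists (w' - w).
by rewrite mulmxBr -zw -zw' opprB [RHS]addrC addrA subrK.
Qed.
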